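(* $R(W_5, W_7)\geq 14$, where $R$ denotes the two-color Ramsey number and $W_n$ denotes the wheel on $n$ vertices in total.
   Context: All graphs are finite, simple and undirected. For graphs $G_1, G_2$, the two-color Ramsey number $R(G_1,G_2)$ is the least integer $n$ such that for any edge-coloring of the complete graph $K_n$ with 2 colors there exists some $i\in\{1,2\}$ such that the subgraph of $K_n$ formed by the edges of color $i$ contains a copy of $G_i$ as a (not necessarily induced) subgraph. For two graphs $G$ and $H$, the join $G+H$ is the graph obtained from the disjoint union of $G$ and $H$ by adding all the edges between a vertex of $G$ and a vertex of $H$. The wheel $W_n$ is the join $K_1+C_{n-1}$ of a central vertex and a cycle on $n-1$ vertices (so $W_5=K_1+C_4$ and $W_7=K_1+C_6$). *)

(* Defs.v *)
From mathcomp Require Import all_boot.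
Set Implicit Arguments.
Unset Strict Implicit.
Unset Printing Implicit Defensive.

Record sgraph := SGraph {
  vertex :> finType;
  edge : rel vertex;
  edge_sym : symmetric edge;
  edge_irr : irreflexive edge }.
Arguments edge {s}.

Definition contains_copy (H G : sgraph) : bool :=
  [exists f : {ffun G -> H}, injectiveb f &&
    [forall x, forall y, edge x y ==> edge (f x) (f y)]].

Section Complete.
Variable n : nat.
Definition complete_edge : rel 'I_n := fun x y => x != y.
Fact complete_sym : symmetric complete_edge.
Proof. by move=> x y; rewrite /complete_edge eq_sym. Qed.
Fact complete_irr : irreflexive complete_edge.
Proof. by move=> x; rewrite /complete_edge eqxx. Qed.
Definition complete_graph := SGraph complete_sym complete_irr.
End Complete.

(* This is the cycle C_n only for n >= 3; the clause x != y removes the loop   *)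
(* that would otherwise occur at n = 1.                                        *)
Section Cycle.
Variable n : nat.
Definition cycle_edge : rel 'I_n := fun x y =>
  (x != y) && ((y == x.+1 %% n :> nat) || (x == y.+1 %% n :> nat)).
Fact cycle_sym : symmetric cycle_edge.
Proof. by move=> x y; rewrite /cycle_edge eq_sym orbC. Qed.
Fact cycle_irr : irreflexive cycle_edge.
Proof. by move=> x; rewrite /cycle_edge eqxx. Qed.
Definition cycle_graph := SGraph cycle_sym cycle_irr.
End Cycle.

Section Join.
Variables G H : sgraph.
Definition join_edge : rel (G + H)%type := fun u v =>
  match u, v with
  | inl x, inl y => edge x y
  | inr x, inr y => edge x y
  | _, _ => true
  end.
Fact join_sym : symmetric join_edge.
Proof. by move=> [x|x] [y|y] //=; rewrite edge_sym. Qed.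
Fact join_irr : irreflexive join_edge.
Proof. by move=> [x|x] /=; rewrite edge_irr. Qed.
Definition join_graph := SGraph join_sym join_irr.
End Join.

Definition wheel (n : nat) : sgraph :=
  join_graph (complete_graph 1) (cycle_graph n.-1).

(* A coloring assigns a color to every set of vertices, but only its values on *)
(* the two-element sets, i.e. on the edges of K_n, are ever used.              *)
Definition coloring (n : nat) := {ffun {set 'I_n} -> bool}.

Section ColorGraph.
Variables (n : nat) (c : coloring n) (i : bool).
Definition color_edge : rel 'I_n := fun x y =>
  @edge (complete_graph n) x y && (c [set x; y] == i).
Fact color_sym : symmetric color_edge.
Proof. by move=> x y; rewrite /color_edge edge_sym setUC. Qed.
Fact color_irr : irreflexive color_edge.
Proof. by move=> x; rewrite /color_edge edge_irr. Qed.
Definition color_graph := SGraph color_sym color_irr.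
End ColorGraph.

(* The colors 1 and 2 are true and false respectively.                         *)
Definition ramsey_prop (G1 G2 : sgraph) (n : nat) : bool :=
  [forall c : coloring n,
    contains_copy (color_graph c true) G1 ||
    contains_copy (color_graph c false) G2].

Section RamseyExists.

Definition homog (T : finType) (e : rel T) (b : bool) (B : {set T}) :=
  {in B &, forall x y, x != y -> e x y = b}.

Lemma homogU1 (T : finType) (e : rel T) b (B : {set T}) v :
  symmetric e -> homog e b B -> {in B, forall x, e v x = b} ->
  homog e b (v |: B).
Proof.
move=> se hB hv x y /setU1P[->|xB] /setU1P[->|yB] xy; first by rewrite eqxx in xy.
- exact: hv.
- by rewrite se; apply: hv.
- exact: hB.
Qed.

Lemma ramsey_cliques (k l : nat) : exists N, forall (T : finType) (e : rel T),
  symmetric e -> forall A : {set T}, N <= #|A| ->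
  (exists B : {set T}, [/\ B \subset A, #|B| = k & homog e true B]) \/
  (exists B : {set T}, [/\ B \subset A, #|B| = l & homog e false B]).
Proof.
have empty (T : finType) (e : rel T) b (A : {set T}) :
  exists B : {set T}, [/\ B \subset A, #|B| = 0 & homog e b B].
  by exists set0; split; rewrite ?sub0set ?cards0 // => x y; rewrite inE.
elim: k l => [|k IHk]; first by exists 0 => T e _ A _; left; apply: empty.
elim=> [|l [N2 IHl]]; first by exists 0 => T e _ A _; right; apply: empty.
have [N1 {}IHk] := IHk l.+1.
exists (N1 + N2).+1 => T e se A hA.
have /card_gt0P[v vA] : 0 < #|A| by apply: leq_trans hA.
pose A1 := [set x in A :\ v | e v x]; pose A2 := [set x in A :\ v | ~~ e v x].
have extend b (B : {set T}) m : B \subset [set x in A :\ v | e v x == b] ->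
    #|B| = m -> homog e b B ->
    exists B : {set T}, [/\ B \subset A, #|B| = m.+1 & homog e b B].
  move=> /subsetP sB cB hB; exists (v |: B); split.
  - by apply/subsetP=> x /setU1P[->//|/sB]; rewrite !inE => /andP[/andP[]].
  - rewrite cardsU1 cB; case: (boolP (v \in B)) => // /sB.
    by rewrite !inE eqxx.
  - by apply: homogU1 => // x /sB; rewrite !inE => /andP[_ /eqP].
have sA1 : A1 \subset A by apply/subsetP=> x; rewrite !inE => /andP[/andP[]].
have sA2 : A2 \subset A by apply/subsetP=> x; rewrite !inE => /andP[/andP[]].
have cA : #|A1| + #|A2| = #|A :\ v|.
  rewrite -(cardsID [set x | e v x] (A :\ v)); congr (_ + _); apply: eq_card => x.
    by rewrite !inE.
  by rewrite !inE andbC.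
have cN : N1 + N2 <= #|A1| + #|A2|.
  by rewrite cA; move: hA; rewrite (cardsD1 v A) vA.
have [h1|h1] := leqP N1 #|A1|.
  case: (IHk T e se A1 h1) => -[B [sB cB hB]].
    left; apply: (extend true B) => //; apply: (subset_trans sB).
    by apply/subsetP=> x; rewrite !inE eqb_id.
  by right; exists B; split=> //; apply: subset_trans sA1.
have h2 : N2 <= #|A2|.
  by rewrite -(leq_add2l N1); apply: (leq_trans cN); rewrite leq_add2r ltnW.
case: (IHl T e se A2 h2) => -[B [sB cB hB]].
  by left; exists B; split=> //; apply: subset_trans sA2.
right; apply: (extend false B) => //; apply: (subset_trans sB).
by apply/subsetP=> x; rewrite !inE eqbF_neg.
Qed.

Lemma homog_copy n (c : coloring n) b (G : sgraph) (B : {set 'I_n}) :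
  #|B| = #|G| -> homog (fun x y => c [set x; y]) b B ->
  contains_copy (color_graph c b) G.
Proof.
move=> cB hB.
pose f (x : G) : 'I_n := enum_val (cast_ord (esym cB) (enum_rank x)).
have fI : injective f.
  by move=> x y /enum_val_inj/cast_ord_inj/enum_rank_inj.
apply/existsP; exists [ffun x => f x]; apply/andP; split.
  by apply/injectiveP=> x y; rewrite !ffunE => /fI.
apply/forallP=> x; apply/forallP=> y; apply/implyP=> xy; rewrite !ffunE.
have nxy : f x != f y.
  by rewrite (inj_eq fI); apply: contraTneq xy => ->; rewrite edge_irr.
by rewrite /= /color_edge /= /complete_edge nxy hB ?enum_valP ?eqxx.
Qed.

Lemma ramsey_exists (G1 G2 : sgraph) : exists n, ramsey_prop G1 G2 n.
Proof.
have [N hN] := ramsey_cliques #|G1| #|G2|.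
exists N; apply/forallP=> c; apply/orP.
have se : symmetric (fun x y => c [set x; y]) by move=> x y; rewrite setUC.
case: (hN _ _ se [set: 'I_N]); first by rewrite cardsT card_ord.
  by move=> [B [_ cB hB]]; left; apply: homog_copy cB hB.
by move=> [B [_ cB hB]]; right; apply: homog_copy cB hB.
Qed.

End RamseyExists.

Definition ramsey (G1 G2 : sgraph) : nat := ex_minn (ramsey_exists G1 G2).

(* Main.v *)
Require Import Defs.
From mathcomp Require Import all_boot.
Set Implicit Arguments.
Unset Strict Implicit.
Unset Printing Implicit Defensive.

(** A red graph on 13 vertices without W_5 whose complement has no W_7 (found by
    computer search) gives the bound: its induced subgraphs colour every K_n with
    n <= 13. A wheel in a graph is a closed walk without repetition inside the
    neighbourhood of a vertex, so it is excluded by enumerating such walks. *)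

(** The start [x] is left out of each listed walk, as in [path e x p]. Walks that repeat a vertex
    are kept here and discarded by [uniq] in [wheel_free]. *)
Fixpoint walks {T : Type} (e : rel T) (V : seq T) (k : nat) (x : T) :
    seq (seq T) :=
  if k is k'.+1
  then [seq y :: p | y <- [seq y <- V | e x y], p <- walks e V k' y]
  else [:: [::]].

Lemma mem_walks (T : eqType) (e : rel T) (V : seq T) (x : T) (p : seq T) :
  path e x p -> {subset p <= V} -> p \in walks e V (size p) x.
Proof.
elim: p x => [|y p IHp] x //= /andP[exy yp] sV.
apply/allpairsPdep; exists y, p; split=> //.
  by rewrite mem_filter exy sV ?mem_head.
by apply: IHp => // z zp; apply: sV; rewrite inE zp orbT.
Qed.

(* The rim has [k.+1] vertices, hence the wheel is W_(k+2). *)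
Definition wheel_free {T : eqType} (e : rel T) (V : seq T) (k : nat) : bool :=
  all (fun h => let N := [seq y <- V | e h y] in
    all (fun x => all (fun p => ~~ (uniq (x :: p) && e (last x p) x))
      (walks e N k x)) N) V.

(** The map [g] carries a copy to a type where [wheel_free] can be computed. The images of the rim
    are neighbours of the image of the hub; read in cyclic order from index 0, they form a closed
    walk of the kind that the check rules out. *)
Lemma wheel_free_no_copy (T : eqType) (e : rel T) (V : seq T) (k : nat)
    (G : sgraph) (g : G -> T) :
  0 < k -> injective g -> (forall x, g x \in V) ->
  (forall x y, edge x y -> e (g x) (g y)) ->
  wheel_free e V k -> ~~ contains_copy G (wheel k.+2).
Proof.
move=> k_gt0 g_inj gV ge eV.
apply/existsP=> -[f /andP[/injectiveP f_inj /forallP fe]].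
have {}fe u v : @edge (wheel k.+2) u v -> e (g (f u)) (g (f v)).
  by move=> uv; apply: ge; move/forallP/(_ v)/implyP: (fe u); apply.
(* [inord] lets the rim be indexed by natural numbers; only [i <= k] is meaningful. *)
pose h := g (f (inl ord0)); pose r i := g (f (inr (inord i))).
pose N := [seq y <- V | e h y]; pose p := [seq r i | i <- iota 1 k].
have rN i : r i \in N by rewrite mem_filter gV fe.
have size_p : size p = k by rewrite size_map size_iota.
have rE i : i <= k -> nth (r 0) (r 0 :: p) i = r i.
  by move=> ik; rewrite -[r 0 :: p]/(map r (iota 0 k.+1)) (nth_map 0)
    ?size_iota // nth_iota.
have p_walk : p \in walks e N k (r 0).
  rewrite -{1}size_p; apply: mem_walks; last by move=> _ /mapP[i _ ->].
  apply/(pathP (r 0)) => i; rewrite size_p => ik.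
  rewrite rE ?(ltnW ik) // -[nth _ p i]/(nth (r 0) (r 0 :: p) i.+1) rE //.
  apply: fe; rewrite /= /cycle_edge -val_eqE /= !inordK ?(ltnW ik) //.
    by rewrite modn_small // eqxx ltn_eqF.
  by rewrite ltnS ltnW.
have := allP (allP (allP eV h (gV _)) (r 0) (rN 0)) p p_walk.
case/negP; apply/andP; split.
  rewrite -[r 0 :: p]/(map r (iota 0 k.+1)) map_inj_in_uniq ?iota_uniq //.
  move=> i j; rewrite !mem_iota !add0n => ik jk /g_inj/f_inj[].
  by move/(congr1 val); rewrite /= !inordK.
(* The closing edge joins rim indices [k] and 0: [k.+1] is 0 modulo [k.+1], and [0 < k] makes the
   two ends distinct. *)
rewrite (last_nth (r 0)) size_p rE //; apply: fe.
rewrite /= /cycle_edge -val_eqE /= !inordK // modnn eqxx andbT.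
by rewrite -lt0n.
Qed.

(* Vertices [i] and [6 + i], for [i] in Z/6, form two orbits of the rotation
   [i |-> i + 1], which fixes the vertex 12. *)
Definition red_arc (x y : nat) : bool :=
  [|| [&& x < 6, y < 6 & y == x.+1 %% 6],
      [&& x < 6, 6 <= y < 12 & (y - x) %% 6 \in [:: 1; 2; 4]],
      (x < 6) && (y == 12)
    | [&& 6 <= x < 12, 6 <= y < 12 & (y + 6 - x) %% 6 \in [:: 1; 3]]].

Definition red : rel nat := fun x y => red_arc x y || red_arc y x.
Definition blue : rel nat := fun x y => (x != y) && ~~ red x y.

Lemma red_irr (x : nat) : x < 13 -> red x x = false.
Proof.
have /allP irr : all (fun x => ~~ red x x) (iota 0 13) by vm_compute.
by move=> x_lt; apply/negbTE/irr; rewrite mem_iota.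
Qed.

Lemma red_wheel_free : wheel_free red (iota 0 13) 3.
Proof. by vm_compute. Qed.

Lemma blue_wheel_free : wheel_free blue (iota 0 13) 5.
Proof. by vm_compute. Qed.

Definition red_coloring (n : nat) : coloring n :=
  [ffun S : {set 'I_n} => [exists x in S, exists y in S, red x y]].

Lemma red_coloringE (n : nat) (x y : 'I_n) :
  n <= 13 -> red_coloring n [set x; y] = red x y.
Proof.
move=> n_le; have irr (z : 'I_n) : red z z = false.
  by rewrite red_irr // (leq_trans (ltn_ord z)).
rewrite ffunE; apply/exists_inP/idP => [[u uS /exists_inP[v vS]]|xy].
  (* The two members found may coincide, which irreflexivity excludes; otherwise they are [x] and
     [y] in some order. *)
  by case/set2P: uS => ->; case/set2P: vS => ->; rewrite ?irr // /red orbC.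
by exists x; rewrite ?set21 //; apply/exists_inP; exists y; rewrite ?set22.
Qed.

(** Since [ramsey] is a least element, refuting every [n <= 13] at once avoids showing that
    [ramsey_prop] is monotone in [n]. *)
Lemma ramsey_prop_lower (n : nat) :
  n <= 13 -> ~~ ramsey_prop (wheel 5) (wheel 7) n.
Proof.
move=> n_le; apply/forallPn; exists (red_coloring n).
have ltV (x : 'I_n) : val x \in iota 0 13.
  by rewrite mem_iota (leq_trans (ltn_ord x)).
rewrite negb_or; apply/andP; split.
  apply: (@wheel_free_no_copy _ _ _ 3 (color_graph _ true) val
    isT val_inj ltV _ red_wheel_free) => x y.
  by case/andP=> _; rewrite red_coloringE // => /eqP.
apply: (@wheel_free_no_copy _ _ _ 5 (color_graph _ false) val
  isT val_inj ltV _ blue_wheel_free) => x y.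
by case/andP=> xy; rewrite red_coloringE // /blue => /eqP->; rewrite andbT.
Qed.

Theorem theorem3p1 : 14 <= ramsey (wheel 5) (wheel 7).
Proof.
rewrite /ramsey; case: ex_minnP => n n_ramsey _.
by rewrite ltnNge; apply: contraL n_ramsey; apply: ramsey_prop_lower.
Qed.
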